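(* Let $n$ be a prime number. Let $\mathsf{T}$ be a nice triangulation of $\Delta^{n-1}$ and let $\Lambda$ be a nice labeling of the vertices of $\mathsf{T}$ with nonempty proper subsets of $[n]$. Then there is an $(n-1)$-dimensional simplex $\tau\in\mathsf{T}$ such that it is possible to pick a distinct label in each $\Lambda(u)$ when $u$ runs over the vertices of $\tau$ (i.e., there is an injective choice $u\mapsto \ell(u)\in\Lambda(u)$ over the vertices $u$ of $\tau$).
   Context: $\Delta^{n-1}=\{(x_1,\dots,x_n)\in\mathbb{R}^n_{\ge 0}\colon \sum_i x_i=1\}$, with vertices the standard unit vectors $\boldsymbol{e}_1,\dots,\boldsymbol{e}_n$. For $j\in[n]$, the $\widehat{j}$-facet is the facet $\{x_j=0\}$. For $j\in[n]$, $\rho^j$ is the permutation of $[n]$ with $\rho^j(1)=j$, $\rho^j(i)=i-1$ for $2\le i\le j$, and $\rho^j(i)=i$ for $i\ge j+1$; $r^j$ is the linear map of $\mathbb{R}^n$ with $r^j(\boldsymbol{e}_i)=\boldsymbol{e}_{\rho^j(i)}$. A triangulation $\mathsf{T}$ of $\Delta^{n-1}$ is nice if $r^j(\sigma)\in\mathsf{T}$ for every $j\in[n]$ and every simplex $\sigma\in\mathsf{T}$ contained in the $\widehat{1}$-facet. A labeling $\Lambda$ of the vertices of $\mathsf{T}$ by subsets of $[n]$ is nice if $\Lambda(r^j(v))=\rho^j(\Lambda(v))$ for every $j\in[n]$ and every vertex $v$ of $\mathsf{T}$ lying in the $\widehat{1}$-facet. *)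

(* Defs.v *)
(* World: MathComp, with the real numbers and sets of MathComp-Analysis. *)
From mathcomp Require Import all_boot all_order all_fingroup all_algebra.
From mathcomp Require Import finmap boolp classical_sets reals.
From mathcomp Require Import zify.

Set Implicit Arguments.
Unset Strict Implicit.
Unset Printing Implicit Defensive.

Import Order.TTheory GRing.Theory Num.Theory.
Local Open Scope classical_set_scope.
Local Open Scope ring_scope.

(* The index set [n] = {1, ..., n} is 'I_n = {0, ..., n-1}, shifted by one:
   below, the index 1 is the i1 : 'I_n with i1 = 0%N :> nat. *)

Lemma rho_subproof n (j i : 'I_n) :
  ((if i == 0 :> nat then j : nat else if i <= j then i.-1 else i) < n)%N.
Proof. by case: i j => [i ?] [j ?] /=; repeat case: ifP => ?; lia. Qed.

Definition rho_fun n (j i : 'I_n) : 'I_n := Ordinal (rho_subproof j i).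

Lemma rho_fun_inj n (j : 'I_n) : injective (rho_fun j).
Proof.
case: j => j ? [a ?] [b ?] /(congr1 val) /= H; apply/val_inj => /=; move: H.
by repeat case: ifP => ?; lia.
Qed.

Definition rho n (j : 'I_n) : 'S_n := perm (@rho_fun_inj n j).

Section Triangulations.
Variables (R : realType) (n : nat).
Implicit Types (x v : 'rV[R]_n) (s t u : {fset 'rV[R]_n}).
Implicit Types (T : {fset {fset 'rV[R]_n}}).

(* The standard unit vector e_i of R^n is delta_mx 0 i. *)
Definition r (j : 'I_n) x : 'rV[R]_n :=
  \sum_(i < n) x 0 i *: delta_mx 0 (rho j i).

Definition std_simplex : set 'rV[R]_n :=
  [set x | (forall i, 0 <= x 0 i) /\ \sum_(i < n) x 0 i = 1].

Definition facet (i : 'I_n) : set 'rV[R]_n :=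
  [set x | std_simplex x /\ x 0 i = 0].

(* A simplex is represented by its finite set of vertices. *)
Definition hull s : set 'rV[R]_n :=
  [set x | exists w : 'rV[R]_n -> R,
     [/\ forall v, v \in s -> 0 <= w v,
         \sum_(v <- s) w v = 1 &
         x = \sum_(v <- s) w v *: v]].

Definition affinely_independent s : Prop :=
  forall w : 'rV[R]_n -> R,
    \sum_(v <- s) w v = 0 -> \sum_(v <- s) w v *: v = 0 ->
    forall v, v \in s -> w v = 0.

(* The empty simplex is not a member of a triangulation. In the third
   condition the common face u may be empty, and then hull u = set0. *)
Definition triangulation T : Prop :=
  [/\ forall s, s \in T -> s != fset0 /\ affinely_independent s,
      forall s t, s \in T -> t != fset0 -> (t `<=` s)%fset -> t \in T,
      forall s t, s \in T -> t \in T ->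
        exists u, [/\ (u `<=` s)%fset, (u `<=` t)%fset &
                      hull s `&` hull t = hull u] &
      \bigcup_(s in [set s | s \in T]) hull s = std_simplex].

Definition simplex_dim s : nat := #|` s|.-1.

Definition vertex T v : Prop := [fset v]%fset \in T.

(* Since r j is linear and injective, the vertices of r j (hull s) are the
   images of the vertices of s. *)
Definition nice_triangulation T : Prop :=
  triangulation T /\
  forall i1 j : 'I_n, i1 = 0%N :> nat ->
  forall s, s \in T -> hull s `<=` facet i1 -> [fset r j v | v in s]%fset \in T.

(* A labeling is a total function on R^n; only its values at the vertices of T
   matter. *)
Definition nice_labeling T (L : 'rV[R]_n -> {set 'I_n}) : Prop :=
  forall i1 j : 'I_n, i1 = 0%N :> nat ->
  forall v, vertex T v -> facet i1 v -> L (r j v) = (rho j @: L v)%SET.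

End Triangulations.

(* Main.v *)
Require Import Defs.
From mathcomp Require Import all_boot all_order all_fingroup all_algebra.
From mathcomp Require Import finmap boolp classical_sets reals.
From mathcomp Require Import zify lra.

Set Implicit Arguments.
Unset Strict Implicit.
Unset Printing Implicit Defensive.

Import Order.TTheory GRing.Theory Num.Theory.
Local Open Scope ring_scope.

(* Let a(v) be the vector with entry (n-1)!/|L v| at the indices in L v and 0
   elsewhere. It is integral and its coordinates sum to (n-1)!, because L v is
   nonempty and proper. If there is no transversal, then det (a(v_1), ..., a(v_n))
   = 0 on every simplex. Weighting each ordered simplex with its geometric
   orientation, a discrete Stokes formula transports this to the boundary. Let
   x_t be the oriented sum, over the ordered (n-1)-tuples of the facet
   {x_1 = 0}, of (-1)^t times the minor of a that omits the column t. Since the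
   facet j is the image of the facet 1 under r^j, for every c
     sum_j x_{(rho^j)^{-1}(c)} = x_1 + (n - c) x_{c+1} + (c - 1) x_c = 0,
   so modulo n all the x_t are equal and sum_t x_t = 0.
   On the other hand sum_t x_t is the oriented sum of the determinants of
   alpha(v) = a(v) - a(v)_1 (1, ..., 1). On the facet {x_1 = 0} niceness gives
   a(v)_i = a(v)_1 whenever v_i = 0, so alpha(v)_i = 0 there; and modulo n the
   coordinates of alpha(v) still sum to (n-1)!. A determinantal Sperner lemma
   then evaluates the sum to (n-1)! ((n-1)!)^(n-1), which is nonzero modulo the
   prime n. *)

(** * Cofaces in a simplicial subdivision of the positive orthant *)

(* The cones over the simplices of a triangulation. The empty simplex belongs
   to K, and the last two fields say that every point of the orthant has
   exactly one representation by nonnegative weights supported on a simplex. *)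
Record cone_complex (R : realFieldType) (n : nat) (I : finType)
    (p : I -> 'rV[R]_n) (K : pred {set I}) : Prop := ConeComplex {
  cc_ge0 : forall v i, 0 <= p v 0 i;
  cc_sub : forall s t : {set I}, t \subset s -> K s -> K t;
  cc_free : forall (s : {set I}) (w : I -> R), K s ->
    (forall v, v \notin s -> w v = 0) -> \sum_v w v *: p v = 0 ->
    forall v, w v = 0;
  cc_uniq : forall (s t : {set I}) (w z : I -> R), K s -> K t ->
    (forall v, 0 <= w v) -> (forall v, 0 <= z v) ->
    (forall v, v \notin s -> w v = 0) -> (forall v, v \notin t -> z v = 0) ->
    \sum_v w v *: p v = \sum_v z v *: p v -> w =1 z;
  cc_cover : forall y : 'rV[R]_n, (forall i, 0 <= y 0 i) ->
    exists (s : {set I}) (w : I -> R),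
    [/\ K s, forall v, 0 <= w v, forall v, v \notin s -> w v = 0 &
        y = \sum_v w v *: p v] }.

Lemma small_eps_pigeonhole (R : realFieldType) (S : finType)
    (P : S -> R -> Prop) :
  (forall e, 0 < e -> exists s, P s e) ->
  exists s, forall d, 0 < d -> exists2 e, 0 < e < d & P s e.
Proof.
move=> exP; apply/not_existsP => noP.
have {noP} /choice [d dP] : forall s, exists d,
    0 < d /\ forall e, 0 < e < d -> ~ P s e.
  move=> s; have /existsNP [d /not_implyP [d0 nd]] := noP s.
  exists d; split=> // e ed Pe; apply: nd; by exists e.
pose m := \big[Num.min/1]_s d s.
have m0 : 0 < m.
  rewrite /m; elim/big_ind : _ => // [x y x0 y0|s _]; first by rewrite lt_min x0.
  by have [] := dP s.
have [s Ps] : exists s, P s (m / 2) by apply: exP; rewrite divr_gt0.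
have [d0 /(_ (m / 2)) H] := dP s.
apply: H Ps; rewrite divr_gt0 //=.
apply: (@lt_le_trans _ _ m); first by lra.
by rewrite /m (bigD1 s) //= ge_min lexx.
Qed.

Lemma ge0_of_small_eps (R : realFieldType) (a b : R) :
  (forall d, 0 < d -> exists2 e, 0 < e < d & 0 <= a + e * b) -> 0 <= a.
Proof.
move=> H; rewrite leNgt; apply/negP => a0.
have b0 : 0 < 1 + `|b| by rewrite ltr_pwDl.
have [|e /andP [e0 ed]] := H (- a / (1 + `|b|)); first by rewrite divr_gt0 // oppr_gt0.
rewrite leNgt => /negP; apply.
move: ed; rewrite ltr_pdivlMr // => ed.
have : e * b <= e * `|b| by rewrite ler_wpM2l ?ler_norm // ltW.
lra.
Qed.

Section Cofaces.
Variables (R : realFieldType) (n : nat) (I : finType).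
Variables (p : I -> 'rV[R]_n) (K : pred {set I}).
Hypothesis ccK : cone_complex p K.

(* Some simplex contains [b + e *: w] for arbitrarily small [e > 0], and its
   weights are affine in [e]. *)
Lemma cone_segment (b w : 'rV[R]_n) :
  (forall i, 0 <= b 0 i) -> (forall i, 0 <= w 0 i) ->
  exists (s : {set I}) (l m : I -> R),
  [/\ K s,
      forall v, v \notin s -> l v = 0 /\ m v = 0,
      b = \sum_v l v *: p v /\ w = \sum_v m v *: p v,
      forall v, 0 <= l v &
      forall v, l v = 0 -> 0 <= m v].
Proof.
move=> b0 w0.
pose P (s : {set I}) (e : R) := K s /\ exists l : I -> R,
  [/\ forall v, 0 <= l v, forall v, v \notin s -> l v = 0 &
      b + e *: w = \sum_v l v *: p v].
have [|s Hs] := @small_eps_pigeonhole R _ P.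
  move=> e e0; have [|s [l [Ks l0 ls E]]] := cc_cover ccK (y := b + e *: w).
    by move=> i; rewrite !mxE addr_ge0 // mulr_ge0 // ltW.
  by exists s; split=> //; exists l.
have [e1 /andP [e10 _] [Ks [l1 [l10 l1s E1]]]] := Hs 1 ltr01.
have [e2 /andP [e20 e21] [_ [l2 [l20 l2s E2]]]] := Hs e1 e10.
have d0 : e1 - e2 != 0 by rewrite subr_eq0 gt_eqF.
pose m v := (l1 v - l2 v) / (e1 - e2).
pose l v := l1 v - e1 * m v.
have Ew : w = \sum_v m v *: p v.
  have -> : w = (e1 - e2)^-1 *: ((b + e1 *: w) - (b + e2 *: w)).
    by rewrite opprD addrACA subrr add0r -scalerBl scalerA mulVf ?scale1r.
  rewrite E1 E2 -sumrB scaler_sumr; apply: eq_bigr => v _.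
  by rewrite -scalerBl scalerA mulrC.
have Eb : b = \sum_v l v *: p v.
  transitivity ((b + e1 *: w) - e1 *: w); first by rewrite addrK.
  rewrite E1 {1}Ew scaler_sumr -sumrB; apply: eq_bigr => v _.
  by rewrite scalerA -scalerBl.
have ms v : v \notin s -> m v = 0.
  by move=> vs; rewrite /m l1s // l2s // subrr mul0r.
have ls v : v \notin s -> l v = 0.
  by move=> vs; rewrite /l l1s // ms // mulr0 subrr.
have small v d : 0 < d -> exists2 e, 0 < e < d & 0 <= l v + e * m v.
  move=> d1; have [e ed [_ [l' [l'0 l's E']]]] := Hs d d1.
  exists e => //.
  suff -> : l v + e * m v = l' v by [].
  apply/eqP; rewrite -subr_eq0; apply/eqP.
  apply: (cc_free ccK (w := fun v => l v + e * m v - l' v) Ks).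
    by move=> u us; rewrite ls // ms // l's // mulr0 addr0 subrr.
  under eq_bigr => u _ do rewrite scalerBl scalerDl -scalerA.
  by rewrite sumrB big_split /= -scaler_sumr -Eb -Ew -E' subrr.
exists s, l, m; split=> //.
- by move=> v vs; rewrite ms // ls.
- by move=> v; apply: ge0_of_small_eps; exact: small.
- move=> v lv; have [e /andP [e0 _]] := small v 1 ltr01.
  by rewrite lv add0r pmulr_rge0.
Qed.

Lemma coface_exists (q : nat) (c : 'I_q -> 'I_n) (C : 'I_q -> R) (G : {set I})
    (w : 'rV[R]_n) :
  K G ->
  (forall t, t \in G -> \sum_j p t 0 (c j) * C j = 0) ->
  (forall t i, t \in G -> i \notin codom c -> p t 0 i = 0) ->
  (forall i, 0 <= w 0 i) ->
  (forall i, i \notin codom c -> w 0 i = 0) ->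
  0 < \sum_j w 0 (c j) * C j ->
  exists v, [/\ K (v |: G), forall i, i \notin codom c -> p v 0 i = 0 &
                0 < \sum_j p v 0 (c j) * C j].
Proof.
move=> KG GC Gc w0 wc wC.
have b0 i : 0 <= (\sum_(t in G) p t) 0 i.
  by rewrite summxE sumr_ge0 // => t _; exact: (cc_ge0 ccK).
have [s [l [m [Ks lms [Eb Ew] l0 m0]]]] := cone_segment b0 w0.
pose g v : R := (v \in G)%:R.
have lg : l =1 g.
  apply: (cc_uniq ccK Ks KG) => //.
  - by move=> v /lms [].
  - by move=> v /negPf; rewrite /g => ->.
  rewrite -Eb big_mkcond; apply: eq_bigr => v _; rewrite /g.
  by case: ifP; rewrite ?scale1r ?scale0r.
have mG v : v \notin G -> 0 <= m v.
  by move=> vG; apply: m0; rewrite lg /g (negPf vG).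
have Gs : G \subset s.
  apply/fintype.subsetP => v vG; apply: contraT => /lms [].
  by rewrite lg /g vG => /eqP; rewrite oner_eq0.
pose psi v := \sum_j p v 0 (c j) * C j.
have : 0 < \sum_v m v * psi v.
  suff <- : \sum_j w 0 (c j) * C j = \sum_v m v * psi v by [].
  under [RHS]eq_bigr => v _ do rewrite mulr_sumr.
  rewrite exchange_big /=; apply: eq_bigr => j _.
  rewrite Ew summxE mulr_suml; apply: eq_bigr => v _.
  by rewrite mxE mulrA.
move=> pos.
have [v /andP [vG vpos]] : exists v, (v \notin G) && (0 < m v * psi v).
  apply/existsP; apply: contraLR pos; rewrite negb_exists => /forallP H.
  rewrite -leNgt; apply: sumr_le0 => v _; have := H v.
  rewrite negb_and negbK => /orP [vG|]; last by rewrite -leNgt.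
  by rewrite /psi GC // mulr0.
have mv : 0 < m v.
  rewrite lt_def mG // andbT; apply: contraTneq vpos => ->.
  by rewrite mul0r ltxx.
exists v; split; last by rewrite -(pmulr_rgt0 _ mv).
- apply: (cc_sub ccK _ Ks); rewrite finset.subUset Gs andbT finset.sub1set.
  by apply: contraLR mv => /lms [_ ->]; rewrite ltxx.
- move=> i ic; have := wc i ic; rewrite Ew summxE => /eqP.
  rewrite psumr_eq0 => [/allP /(_ v)|u _].
    rewrite mem_index_enum mxE => /(_ isT) /=; rewrite mulf_eq0 gt_eqF //=.
    by move=> /eqP.
  rewrite mxE; have [uG|uG] := boolP (u \in G); first by rewrite Gc ?mulr0.
  by rewrite mulr_ge0 ?mG // (cc_ge0 ccK).
Qed.

Lemma coface_unique (G : {set I}) (v v' : I) (a : R) (b : I -> R) :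
  K (v |: G) -> K (v' |: G) -> v' \notin G -> 0 < a ->
  (forall u, u \notin G -> b u = 0) ->
  p v' = a *: p v + \sum_u b u *: p u -> v = v'.
Proof.
move=> Kv Kv' v'G a0 bG E; apply/eqP; apply: contraT => vv'.
pose w u : R := (u == v')%:R + `|b u|.
pose z u : R := a * (u == v)%:R + (`|b u| + b u).
have wz : w =1 z.
  apply: (cc_uniq ccK Kv' Kv).
  - by move=> u; rewrite addr_ge0 ?ler0n.
  - move=> u; apply: addr_ge0; first by rewrite mulr_ge0 ?ler0n // ltW.
    by have := ler_norm (- b u); rewrite normrN -subr_ge0 opprK.
  - move=> u; rewrite !inE negb_or /w => /andP [/negPf -> uG].
    by rewrite bG // normr0 addr0.
  - move=> u; rewrite !inE negb_or /z => /andP [/negPf -> uG].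
    by rewrite bG // normr0 mulr0 !addr0.
  rewrite /w /z.
  under eq_bigr => u _ do rewrite scalerDl.
  under [RHS]eq_bigr => u _ do rewrite !scalerDl -scalerA.
  have delta x : \sum_u (u == x)%:R *: p u = p x.
    rewrite (bigD1 x) //= eqxx scale1r big1 ?addr0 // => u /negPf ->.
    by rewrite scale0r.
  by rewrite !big_split /= -scaler_sumr !delta E -addrA [X in _ + X]addrC.
have := wz v'; rewrite /w /z eqxx eq_sym (negPf vv') bG // normr0.
by rewrite mulr0 !addr0 => /eqP; rewrite oner_eq0.
Qed.

End Cofaces.

Lemma det_col0 (A : comPzRingType) (q : nat) (M : 'M[A]_q) (j : 'I_q) :
  (forall i, M i j = 0) -> \det M = 0.
Proof.
by move=> Mj; rewrite (expand_det_col _ j) big1 // => i _; rewrite Mj mul0r.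
Qed.

Lemma sgz_gt0_lt0 (R : realDomainType) (x : R) : sgz x = (0 < x)%R%:R - (x < 0)%R%:R.
Proof. by case: sgzP. Qed.

Definition tuple_mx (A : Type) (n : nat) (I : Type) (x : I -> 'rV[A]_n)
    (q q' : nat) (f : 'I_q -> I) (c : 'I_q' -> 'I_n) : 'M[A]_(q, q') :=
  \matrix_(i, j) x (f i) 0 (c j).

Definition ffun_cons (I : Type) (q : nat) (v : I) (g : {ffun 'I_q -> I}) :
    {ffun 'I_q.+1 -> I} :=
  [ffun i => if unlift ord0 i is Some k then g k else v].

Lemma ffun_cons0 (I : Type) (q : nat) (v : I) (g : {ffun 'I_q -> I}) :
  ffun_cons v g ord0 = v.
Proof. by rewrite ffunE unlift_none. Qed.

Lemma ffun_consS (I : Type) (q : nat) (v : I) (g : {ffun 'I_q -> I}) k :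
  ffun_cons v g (lift ord0 k) = g k.
Proof. by rewrite ffunE liftK. Qed.

(* The vertices of the coordinate face spanned by the unit vectors e_(c j). *)
Definition in_face (R : realFieldType) (n : nat) (I : finType)
    (p : I -> 'rV[R]_n) (q : nat) (c : 'I_q -> 'I_n) (v : I) : bool :=
  [forall i, (i \in codom c) || (p v 0 i == 0)].

Definition face_tuple (R : realFieldType) (n : nat) (I : finType)
    (p : I -> 'rV[R]_n) (K : pred {set I}) (q q' : nat) (c : 'I_q' -> 'I_n)
    (f : {ffun 'I_q -> I}) : bool :=
  K (f @: 'I_q)%SET && [forall i, in_face p c (f i)].

Definition minor (A : comPzRingType) (q : nat) (M : 'M[A]_(q, q.+1))
    (j : 'I_q.+1) : A :=
  (-1) ^+ j * \det (col' j M).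

Section CofaceSum.
Variables (R : realFieldType) (n : nat) (I : finType).
Variables (p : I -> 'rV[R]_n) (K : pred {set I}).
Hypothesis ccK : cone_complex p K.
Variables (q : nat) (c : 'I_q.+1 -> 'I_n) (g : {ffun 'I_q -> I}).
Hypothesis injc : injective c.
Hypothesis gK : face_tuple p K c g.

Let C j := minor (tuple_mx p g c) j.
Let phi v := \sum_j p v 0 (c j) * C j.
Let G := (g @: 'I_q)%SET.

Lemma det_ffun_cons v : \det (tuple_mx p (ffun_cons v g) c) = phi v.
Proof.
rewrite (expand_det_row _ ord0); apply: eq_bigr => j _.
rewrite mxE ffun_cons0 /cofactor add0n; congr (_ * (_ * \det _)).
by apply/matrixP => i k; rewrite !mxE ffun_consS.
Qed.

Lemma phi_tuple k : phi (g k) = 0.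
Proof.
rewrite -det_ffun_cons.
apply: (determinant_alternate (i1 := ord0) (i2 := lift ord0 k)) => //.
by move=> j; rewrite !mxE ffun_cons0 ffun_consS.
Qed.

Lemma in_faceP v i : in_face p c v -> i \notin codom c -> p v 0 i = 0.
Proof. by move=> /forallP /(_ i) /orP [->|/eqP]. Qed.

Lemma in_face_tuple k : in_face p c (g k).
Proof. by case/andP: gK => _ /forallP. Qed.

Lemma phi_basis v v' : phi v != 0 -> in_face p c v -> in_face p c v' ->
  exists b : I -> R, (forall u, u \notin G -> b u = 0) /\
    p v' = (phi v' / phi v) *: p v + \sum_u b u *: p u.
Proof.
move=> phi0 vc v'c.
pose M := tuple_mx p (ffun_cons v g) c.
have uM : M \in unitmx by rewrite unitmxE unitfE /M det_ffun_cons.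
have [y E] : exists y : 'rV[R]_q.+1,
    p v' = y 0 ord0 *: p v + \sum_k y 0 (lift ord0 k) *: p (g k).
  pose x : 'rV[R]_q.+1 := \row_j p v' 0 (c j).
  exists (x *m invmx M); apply/rowP => i; rewrite !mxE summxE.
  have [/codomP [j ->]|ic] := boolP (i \in codom c).
    have := congr1 (fun z : 'rV_q.+1 => z 0 j) (mulmxKV uM x).
    rewrite mxE big_ord_recl [x 0 j]mxE /= => <-.
    rewrite !mxE ffun_cons0; congr (_ + _); apply: eq_bigr => k _.
    by rewrite !mxE ffun_consS.
  rewrite !in_faceP // mulr0 add0r big1 // => k _.
  by rewrite mxE in_faceP ?mulr0 // in_face_tuple.
have Ephi : phi v' = y 0 ord0 * phi v.
  have Z0 : \sum_j (\sum_k (y 0 (lift ord0 k) *: p (g k)) 0 (c j)) * C j = 0.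
    under eq_bigr => j _ do rewrite mulr_suml.
    rewrite exchange_big big1 //= => k _.
    transitivity (y 0 (lift ord0 k) * phi (g k)).
      by rewrite mulr_sumr; apply: eq_bigr => j _; rewrite mxE mulrA.
    by rewrite phi_tuple mulr0.
  rewrite /phi E; under eq_bigr => j _ do rewrite !mxE summxE mulrDl.
  rewrite big_split /= Z0 addr0 mulr_sumr.
  by under eq_bigr => j _ do rewrite -mulrA.
exists (fun u => \sum_(k | g k == u) y 0 (lift ord0 k)); split.
  move=> u uG; rewrite big1 // => k /eqP gk; case/negP: uG.
  by rewrite -gk imset_f.
rewrite Ephi mulfK // {1}E; congr (_ + _).
rewrite (partition_big g xpredT) //=; apply: eq_bigr => u _.
by rewrite scaler_suml; apply: eq_bigr => k /eqP ->.
Qed.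

Lemma sum_coface_side (e : R) : e != 0 ->
  \sum_(v | K (v |: G) && in_face p c v) (0 < e * phi v)%R%:R
  = [exists j, 0 < e * C j]%R%:R :> int.
Proof.
move=> e0.
have [/existsP [j Cj]|noj] := boolP [exists j, 0 < e * C j].
  have delta x y : (delta_mx 0 x : 'rV[R]_n) 0 y = (y == x)%:R by rewrite mxE.
  have [||||||v [Kv vc vphi]] := coface_exists (c := c) ccK
      (C := fun j => e * C j) (G := G) (w := delta_mx 0 (c j)).
  - by case/andP: gK.
  - move=> t /imsetP [k _ ->].
    under eq_bigr => i _ do rewrite mulrCA.
    by rewrite -mulr_sumr [X in e * X]phi_tuple mulr0.
  - by move=> t i /imsetP [k _ ->]; apply: in_faceP; exact: in_face_tuple.
  - by move=> i; rewrite delta ler0n.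
  - by move=> i ic; rewrite delta; case: eqP ic => // ->; rewrite codom_f.
  - rewrite (bigD1 j) //= delta eqxx mul1r big1 ?addr0 // => i ij.
    by rewrite delta (inj_eq injc) (negPf ij) mul0r.
  have {}vphi : 0 < e * phi v.
    by rewrite /phi mulr_sumr; under eq_bigr => i _ do rewrite mulrCA.
  have {}vc : in_face p c v.
    by apply/forallP => i; case: (boolP (_ \in _)) => //= /vc ->.
  rewrite (bigD1 v) /=; last by rewrite Kv.
  rewrite vphi big1 ?addr0 // => u /andP [/andP [Ku uc] uv].
  have [uphi|//] := boolP (0 < e * phi u); case/eqP: uv.
  have phiv0 : phi v != 0 by apply: contraTneq vphi => ->; rewrite mulr0 ltxx.
  have [b [bG E]] := phi_basis phiv0 vc uc.
  apply/esym; apply: (coface_unique ccK Kv Ku _ _ bG E).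
    apply/imsetP => -[k _ uk]; move: uphi.
    by rewrite uk phi_tuple mulr0 ltxx.
  by rewrite -[_ / _]mul1r -(divff e0) mulf_div divr_gt0.
rewrite big1 // => v _; case: ltP => // vphi; case/negP: noj.
apply: contraLR vphi; rewrite negb_exists => /forallP Cle.
rewrite -leNgt /phi mulr_sumr sumr_le0 // => j _.
rewrite mulrCA mulr_ge0_le0 ?(cc_ge0 ccK) // leNgt; exact: Cle.
Qed.

Let Z j := [forall i, p (g i) 0 (c j) == 0].

Lemma minor_off_facet j i : Z j -> i != j -> C i = 0.
Proof.
move=> /forallP Zj ij; rewrite /C /minor.
have [k jE _] := unlift_some ij.
rewrite (det_col0 (j := k)) ?mulr0 // => l.
by rewrite !mxE -jE; apply/eqP.
Qed.

Lemma facet_of_minor (e : R) j :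
  (forall i, 0 <= e * C i) -> 0 < e * C j -> Z j.
Proof.
move=> Cge Cj; apply/forallP => k; apply/eqP.
have : \sum_i p (g k) 0 (c i) * (e * C i) == 0.
  under eq_bigr => i _ do rewrite mulrCA.
  by rewrite -mulr_sumr [X in e * X]phi_tuple mulr0.
rewrite psumr_eq0 => [/allP /(_ j)|i _].
  by rewrite mem_index_enum mulf_eq0 [_ * C j == 0]gt_eqF // orbF => /(_ isT) /eqP.
by rewrite mulr_ge0 ?(cc_ge0 ccK).
Qed.

(* Each side of a codimension-one simplex in a face carries exactly one coface
   if the face has points on that side, and none otherwise. *)
Lemma coface_sum :
  \sum_(v | K (v |: G) && in_face p c v)
     sgz (\det (tuple_mx p (ffun_cons v g) c)) =
  \sum_(j | Z j) sgz (C j).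
Proof.
under eq_bigr => v _ do rewrite det_ffun_cons sgz_gt0_lt0.
rewrite sumrB.
have /= := sum_coface_side (oner_neq0 R); under eq_bigr => v _ do rewrite mul1r.
move=> ->; have /= N1 : (-1 : R) != 0 by rewrite oppr_eq0 oner_eq0.
have /= := sum_coface_side N1; under eq_bigr => v _ do rewrite mulN1r oppr_gt0.
move=> ->.
have [/existsP [j pj]|npos] := boolP [exists j, 0 < 1 * C j];
  have [/existsP [i ni]|nneg] := boolP [exists j, 0 < -1 * C j].
- rewrite big1 // => k Zk; move: pj ni; rewrite mul1r mulN1r oppr_gt0 => pj ni.
  have [jk|jk] := eqVneq j k; last by move: pj; rewrite (minor_off_facet Zk jk) ltxx.
  have ik : i != k by rewrite -jk; apply: contraTneq ni => ->; rewrite -leNgt ltW.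
  by move: ni; rewrite (minor_off_facet Zk ik) ltxx.
- have Zj : Z j.
    apply: facet_of_minor pj => i; move: nneg; rewrite negb_exists.
    by move=> /forallP /(_ i); rewrite mulN1r oppr_gt0 -leNgt mul1r.
  rewrite (bigD1 j) //= big1 ?addr0 => [|i /andP [_ ij]]; last first.
    by rewrite (minor_off_facet Zj ij) sgz0.
  by move: pj; rewrite mul1r => /gtr0_sgz ->.
- have Zi : Z i.
    apply: facet_of_minor ni => j; move: npos; rewrite negb_exists.
    by move=> /forallP /(_ j); rewrite mulN1r oppr_ge0 -leNgt mul1r.
  rewrite (bigD1 i) //= big1 ?addr0 => [|j /andP [_ ij]]; last first.
    by rewrite (minor_off_facet Zi ij) sgz0.
  by move: ni; rewrite mulN1r oppr_gt0 => /ltr0_sgz ->.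
- rewrite big1 // => j _; apply/eqP; rewrite sgz_eq0 eq_le.
  move: npos nneg; rewrite !negb_exists => /forallP /(_ j) + /forallP /(_ j).
  by rewrite mul1r mulN1r oppr_gt0 -!leNgt => -> ->.
Qed.

End CofaceSum.

(** * The Stokes formula and the Sperner lemma *)

Definition ffun_drop (I : Type) (q : nat) (i : 'I_q.+1)
    (f : {ffun 'I_q.+1 -> I}) : {ffun 'I_q -> I} := [ffun k => f (lift i k)].

Lemma ffun_cons_drop (I : Type) (q : nat) (f : {ffun 'I_q.+1 -> I}) :
  ffun_cons (f ord0) (ffun_drop ord0 f) = f.
Proof.
by apply/ffunP => i; rewrite ffunE; case: unliftP => [k ->|-> //]; rewrite ffunE.
Qed.

Lemma ffun_drop_cons (I : Type) (q : nat) v (g : {ffun 'I_q -> I}) :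
  ffun_drop ord0 (ffun_cons v g) = g.
Proof. by apply/ffunP => i; rewrite ffunE ffun_consS. Qed.

Lemma row'_tuple_mx (A : Type) (n : nat) (I : Type) (x : I -> 'rV[A]_n)
    (q q' : nat) (f : {ffun 'I_q.+1 -> I}) (c : 'I_q' -> 'I_n) (i : 'I_q.+1) :
  row' i (tuple_mx x f c) = tuple_mx x (ffun_drop i f) c.
Proof. by apply/matrixP => k j; rewrite !mxE ffunE. Qed.

Lemma det_rowsum (A : comPzRingType) (q : nat) (N : 'M[A]_q.+1) (a : A)
    (j0 : 'I_q.+1) :
  (forall i, \sum_j N i j = a) ->
  \det N = a * \sum_(i < q.+1) (-1) ^+ i * minor (row' i N) j0.
Proof.
move=> Na.
pose P : 'M[A]_q.+1 := \matrix_(i, j) ((j == j0) || (i == j))%:R.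
have detP : \det P = 1.
  rewrite (expand_det_row _ j0) (bigD1 j0) //= big1 ?addr0 => [|j jj0].
    rewrite mxE eqxx mul1r /cofactor -signr_odd oddD addbb expr0 mul1r.
    rewrite -[RHS](det1 A q); congr (\det _); apply/matrixP => i j; rewrite !mxE.
    by rewrite eq_sym (negPf (neq_lift _ _)) (inj_eq lift_inj).
  by rewrite mxE (negPf jj0) eq_sym (negPf jj0) mul0r.
have NP i j : (N *m P) i j = if j == j0 then a else N i j.
  rewrite mxE; case: eqP => [->|/eqP jj0].
    by rewrite -(Na i); apply: eq_bigr => k _; rewrite mxE eqxx mulr1.
  rewrite (bigD1 j) //= mxE eqxx orbT mulr1 big1 ?addr0 // => k kj.
  by rewrite mxE (negPf jj0) (negPf kj) mulr0.
have -> : \det N = \det (N *m P) by rewrite det_mulmx detP mulr1.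
rewrite (expand_det_col _ j0) mulr_sumr.
apply: eq_bigr => i _; rewrite NP eqxx /cofactor /minor exprD -mulrA.
congr (_ * (_ * (_ * \det _))); apply/matrixP => k l; rewrite 2!mxE NP.
by rewrite eq_sym (negPf (neq_lift _ _)) !mxE.
Qed.

Section Stokes.
Variables (R : realFieldType) (n : nat) (I : finType).
Variables (p : I -> 'rV[R]_n) (K : pred {set I}).
Hypothesis ccK : cone_complex p K.

Lemma face_tuple_cons (q q' : nat) (c : 'I_q' -> 'I_n) v (g : {ffun 'I_q -> I}) :
  face_tuple p K c (ffun_cons v g) =
  face_tuple p K c g && (K (v |: g @: 'I_q)%SET && in_face p c v).
Proof.
rewrite /face_tuple.
have -> : (ffun_cons v g @: 'I_q.+1 = v |: g @: 'I_q)%SET.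
  apply/finset.setP => u; rewrite !inE; apply/imsetP/orP => [[i _ ->]|].
    rewrite ffunE; case: unliftP => [k _|_]; [right|by left].
    by rewrite imset_f.
  case=> [/eqP ->|/imsetP [k _ ->]]; first by exists ord0; rewrite ?ffun_cons0.
  by exists (lift ord0 k); rewrite ?ffun_consS.
have -> : [forall i, in_face p c (ffun_cons v g i)] =
    in_face p c v && [forall i, in_face p c (g i)].
  apply/forallP/andP => [H|[vc /forallP gc] i].
    split; first by rewrite -(ffun_cons0 v g).
    by apply/forallP => i; rewrite -(ffun_consS v g).
  by rewrite ffunE; case: unliftP => [k _|_].
have [Kv /=|Kv] := boolP (K (v |: _)); last by rewrite andbF.
rewrite (cc_sub ccK _ Kv) ?finset.subsetUr //=; exact: andbC.
Qed.

Lemma stokes (A : comPzRingType) (q : nat) (c : 'I_q.+1 -> 'I_n)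
    (B : {ffun 'I_q -> I} -> A) :
  injective c ->
  \sum_(f : {ffun 'I_q.+1 -> I} | face_tuple p K c f)
     (sgz (\det (tuple_mx p f c)))%:~R * \sum_(i < q.+1) (-1) ^+ i * B (ffun_drop i f) =
  q.+1%:R * \sum_(g | face_tuple p K c g) B g *
     (\sum_(j | [forall i, p (g i) 0 (c j) == 0])
        sgz (minor (tuple_mx p g c) j))%:~R.
Proof.
move=> injc.
under eq_bigr => f _ do rewrite mulr_sumr.
rewrite exchange_big /=.
pose S := \sum_(f : {ffun 'I_q.+1 -> I} | face_tuple p K c f)
  (sgz (\det (tuple_mx p f c)))%:~R * B (ffun_drop ord0 f).
rewrite (eq_bigr (fun=> S)) => [|i _]; last first.
  (* [s] moves the omitted position [i] to the front and has sign (-1)^i. *)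
  pose s := lift_perm i ord0 1%g.
  rewrite (reindex_inj (h := fun f : {ffun 'I_q.+1 -> I} => [ffun k => f (s k)])); last first.
    move=> f g /ffunP fg; apply/ffunP => k.
    by have := fg ((s^-1)%g k); rewrite !ffunE permKV.
  apply: eq_big => [f|f _].
    rewrite /face_tuple; congr (K _ && _).
      apply/finset.setP => u; apply/imsetP/imsetP => -[k _ ->].
        by exists (s k); rewrite ?ffunE.
      by exists ((s^-1)%g k); rewrite ?ffunE ?permKV.
    apply/forallP/forallP => H k; last by rewrite ffunE.
    by have := H ((s^-1)%g k); rewrite ffunE permKV.
  have -> : tuple_mx p [ffun k => f (s k)] c = row_perm s (tuple_mx p f c).
    by apply/matrixP => k l; rewrite !mxE ffunE.
  have -> : ffun_drop i [ffun k => f (s k)] = ffun_drop ord0 f.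
    by apply/ffunP => k; rewrite !ffunE lift_perm_lift perm1.
  rewrite row_permE det_mulmx det_perm odd_lift_perm odd_perm1 /= !addbF.
  rewrite sgzM mulrA; congr (_ * _).
  rewrite -[X in _ * X]signr_odd; case: (odd i); rewrite /= ?expr0 ?expr1.
    by rewrite sgzN1 mulN1r mulrN1 rmorphN opprK.
  by rewrite sgz1 mul1r mulr1.
rewrite sumr_const card_ord -[LHS]mulr_natl; congr (_ * _).
rewrite /S (reindex (fun vg : I * {ffun 'I_q -> I} => ffun_cons vg.1 vg.2)) /=.
  rewrite (eq_bigl (fun vg : I * {ffun 'I_q -> I} => face_tuple p K c vg.2 &&
    (K (vg.1 |: vg.2 @: 'I_q)%SET && in_face p c vg.1))); last first.
    by move=> vg; rewrite face_tuple_cons.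
  under eq_bigr => vg _ do rewrite ffun_drop_cons.
  rewrite (reindex (fun gv : {ffun 'I_q -> I} * I => (gv.2, gv.1))) /=; last first.
    by exists (fun vg : I * {ffun 'I_q -> I} => (vg.2, vg.1)) => -[].
  rewrite -(pair_big_dep (face_tuple p K c)
     (fun g v => K (v |: g @: 'I_q)%SET && in_face p c v)
     (fun g v => (sgz (\det (tuple_mx p (ffun_cons v g) c)))%:~R * B g)) /=.
  apply: eq_bigr => g gK; rewrite -(coface_sum ccK injc gK) -mulr_suml mulrC.
  by rewrite raddf_sum.
exists (fun f : {ffun 'I_q.+1 -> I} => (f ord0, ffun_drop ord0 f)) => [[v g] _|f _] /=.
  by rewrite ffun_cons0 ffun_drop_cons.
exact: ffun_cons_drop.
Qed.

Lemma in_face_lift (q : nat) (c : 'I_q.+1 -> 'I_n) v : injective c ->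
  in_face p (c \o lift ord0) v = in_face p c v && (p v 0 (c ord0) == 0).
Proof.
move=> injc; apply/forallP/andP => [H|[/forallP H v0] i].
  split.
    apply/forallP => i; have /orP [/codomP [j ->]|->] := H i; last exact: orbT.
    by rewrite /= codom_f.
  have /orP [/codomP [j /injc /eqP]|//] := H (c ord0).
  by rewrite (negPf (neq_lift _ _)).
have /orP [/codomP [j ->]|->] := H i; last exact: orbT.
case: (unliftP ord0 j) => [k ->|-> //]; last by rewrite v0 orbT.
by apply/orP; left; apply/codomP; exists k.
Qed.

Lemma sperner_sum (A : comPzRingType) (al : I -> 'rV[A]_n) (a : A) (q : nat)
    (c : 'I_q -> 'I_n) :
  injective c ->
  (forall v, in_face p c v -> \sum_i al v 0 i = a) ->
  (forall v i, in_face p c v -> p v 0 i = 0 -> al v 0 i = 0) ->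
  \sum_(f : {ffun 'I_q -> I} | face_tuple p K c f)
    (sgz (\det (tuple_mx p f c)))%:~R * \det (tuple_mx al f c) =
  q`!%:R * a ^+ q.
Proof.
elim: q c => [|q IH] c injc ala al0.
  have all f (g : {ffun 'I_0 -> I}) : f = g by apply/ffunP; case.
  have f0 : {ffun 'I_0 -> I} by apply: ffun0; rewrite card_ord.
  rewrite (big_pred1 f0) => [|f].
    by rewrite !det_mx00 sgz1 fact0 expr0 mulr1.
  rewrite (all f f0) /face_tuple /= eqxx.
  have [s [w [Ks _ _ _]]] := cc_cover ccK (y := 0) (fun i => etrans (congr1 _ (mxE _ _ _ _)) (lexx _)).
  rewrite (cc_sub ccK _ Ks) /=; first by apply/forallP; case.
  by apply/fintype.subsetP => u /imsetP [[]].
pose B g := minor (tuple_mx al g c) ord0.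
have E (f : {ffun 'I_q.+1 -> I}) : face_tuple p K c f ->
    \det (tuple_mx al f c) = a * \sum_(i < q.+1) (-1) ^+ i * B (ffun_drop i f).
  move=> /andP [_ /forallP fc]; rewrite (det_rowsum (a := a) ord0).
    by congr (_ * _); apply: eq_bigr => i _; rewrite row'_tuple_mx.
  move=> i; rewrite -(ala _ (fc i)).
  under eq_bigr => j _ do rewrite mxE.
  rewrite [RHS](bigID (mem (codom c))) /= [X in _ + X]big1 ?addr0.
    have uc : uniq (codom c) by exact/injectiveP.
    by rewrite -[RHS](big_uniq _ uc) big_image.
  by move=> j jc; apply: al0 => //; apply: in_faceP jc.
under eq_bigr => f fK do rewrite (E f fK) mulrCA.
rewrite -mulr_sumr (stokes B injc) mulrCA factS natrM exprS -!mulrA; congr (_ * _).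
rewrite mulrCA; congr (_ * _).
have injc0 : injective (c \o lift ord0) by apply: inj_comp => //; exact: lift_inj.
rewrite -(IH _ injc0) => [|v|v i]; last first.
- by rewrite in_face_lift // => /andP [vc _]; exact: al0.
- by rewrite in_face_lift // => /andP [vc _]; exact: ala.
pose Z (g : {ffun 'I_q -> I}) j := [forall i, p (g i) 0 (c j) == 0].
have faceE (g : {ffun 'I_q -> I}) : face_tuple p K (c \o lift ord0) g =
    face_tuple p K c g && Z g ord0.
  rewrite /face_tuple -andbA; congr (_ && _).
  apply/forallP/andP => [H|[/forallP H /forallP H0] i]; last first.
    by rewrite in_face_lift // H H0.
  by split; apply/forallP => i; have := H i; rewrite in_face_lift // => /andP [].
rewrite (eq_bigl _ _ faceE) [RHS]big_mkcondr; apply: eq_bigr => g gK.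
have B0 j : Z g j -> j != ord0 -> B g = 0.
  move=> /forallP Zj j0; rewrite /B /minor.
  case: (unliftP ord0 j) => [k jE|/eqP]; last by rewrite (negPf j0).
  rewrite (det_col0 (j := k)) ?mulr0 // => i; rewrite !mxE -jE.
  by apply: al0; [case/andP: gK => _ /forallP|apply/eqP].
have minorE (V : comPzRingType) (x : I -> 'rV[V]_n) :
    minor (tuple_mx x g c) ord0 = \det (tuple_mx x g (c \o lift ord0)).
  rewrite /minor expr0 mul1r; congr (\det _).
  by apply/matrixP => i j; rewrite !mxE.
have [/existsP [j /andP [Zj j0]]|noj] := boolP [exists j, Z g j && (j != ord0)].
  by rewrite -(minorE _ al) -/(B g) (B0 j) // mul0r mulr0 if_same.
have Zj j : j != ord0 -> Z g j = false.
  move=> j0; move: noj; rewrite negb_exists => /forallP /(_ j).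
  by rewrite j0 andbT => /negPf.
rewrite big_mkcond (bigD1 ord0) //= big1 ?addr0 => [|j /Zj Zj0]; last first.
  by rewrite -/(Z g j) Zj0.
rewrite -/(Z g ord0); case: ifP => _; last by rewrite mulr0.
by rewrite -!minorE mulrC.
Qed.

End Stokes.

(** * The equivariant argument *)

Lemma rho_lift_perm (m : nat) (j : 'I_m.+1) : rho j = lift_perm ord0 j 1%g.
Proof.
apply/permP => i; rewrite permE; apply/val_inj.
case: (unliftP ord0 i) => [k ->|->]; last by rewrite lift_perm_id.
rewrite lift_perm_lift perm1 /= /bump /=.
by case: leqP; case: leqP => /=; lia.
Qed.

Lemma odd_rho (m : nat) (j : 'I_m.+1) : (rho j : bool) = odd j.
Proof. by rewrite rho_lift_perm odd_lift_perm odd_perm1 addbF. Qed.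

Lemma rho0 (m : nat) (j : 'I_m.+1) : rho j ord0 = j.
Proof. by rewrite rho_lift_perm lift_perm_id. Qed.

Lemma det_col_mx_delta (A : comPzRingType) (m : nat) (M : 'M[A]_(m, m.+1))
    (u : 'rV[A]_m.+1) :
  \det (col_mx u M : 'M_(1 + m)) = \sum_t u 0 t * minor M t.
Proof.
rewrite (expand_det_row _ (ord0 : 'I_(1 + m))); apply: eq_bigr => t _.
have -> : ord0 = lshift m (ord0 : 'I_1) by apply: val_inj.
rewrite col_mxEu /cofactor /minor add0n; congr (_ * (_ * \det _)).
apply/matrixP => i j; rewrite !mxE.
by case: splitP => k /=; rewrite /bump /= ?ord1 //= => /succn_inj /val_inj ->.
Qed.

Lemma minor_perm (A : comPzRingType) (m : nat) (M M' : 'M[A]_(m, m.+1))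
    (s : 'S_m.+1) t :
  (forall k i, M' k (s i) = M k i) -> minor M' (s t) = (-1) ^+ s * minor M t.
Proof.
move=> MM'.
have E N i : minor N i = \det (col_mx (delta_mx 0 i) N : 'M[A]_(1 + m)).
  rewrite det_col_mx_delta (bigD1 i) //= mxE !eqxx mul1r big1 ?addr0 // => j ji.
  by rewrite mxE (negPf ji) andbF mul0r.
rewrite !E -det_perm mulrC -det_mulmx -[s in perm_mx s]invgK.
rewrite -col_permE; congr (\det _); apply/matrixP => i j.
rewrite !mxE; case: splitP => k _; last by rewrite -MM' permKV.
by rewrite !mxE -[in RHS](inj_eq (@perm_inj _ s)) permKV.
Qed.

Lemma sum_minor (A : comPzRingType) (m : nat) (M : 'M[A]_(m, m.+1)) :
  \sum_t minor M t =
  \det (\matrix_(k, l) (M k (lift ord0 l) - M k ord0) : 'M_m).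
Proof.
pose P : 'M[A]_(1 + m) := block_mx 1%:M (const_mx (-1)) 0 1%:M.
have detP : \det P = 1 by rewrite det_ublock !det1 mulr1.
rewrite (eq_bigr (fun t => (const_mx 1 : 'rV_m.+1) 0 t * minor M t)) => [|t _].
  2: by rewrite mxE mul1r.
rewrite -det_col_mx_delta -[LHS]mulr1 -[X in _ * X]detP -det_mulmx.
have -> : (col_mx (const_mx 1) M : 'M_(1 + m)) =
    block_mx (1%:M : 'M_1) (const_mx 1) (lsubmx (M : 'M_(m, 1 + m)))
      (rsubmx (M : 'M_(m, 1 + m))).
  rewrite block_mxEv hsubmxK; congr col_mx; apply/matrixP => i j.
  by rewrite !mxE; case: splitP => k _; rewrite !mxE // !ord1.
rewrite mulmx_block !mulmx0 !mulmx1 !addr0 !mul1mx.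
have -> : const_mx (-1) + const_mx 1 = 0 :> 'rV[A]_m.
  by apply/matrixP => i j; rewrite !mxE addrC subrr.
rewrite det_lblock det1 mul1r; congr (\det _).
apply/matrixP => k l; rewrite !mxE big_ord1 !mxE mulrN1 addrC.
congr (M k _ - M k _); exact: val_inj.
Qed.

Lemma det_neq0_perm (A : comPzRingType) (q : nat) (M : 'M[A]_q) :
  \det M != 0 -> exists s : 'S_q, forall i, M i (s i) != 0.
Proof.
move=> M0; have /existsP [s /forallP Ms] : [exists s : 'S_q, [forall i, M i (s i) != 0]].
  apply: contraNT M0; rewrite negb_exists => /forallP H.
  rewrite /determinant big1 // => s _.
  have := H s; rewrite negb_forall => /existsP [i]; rewrite negbK => /eqP Mi.
  by rewrite (bigD1 i) //= Mi mul0r mulr0.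
by exists s.
Qed.

Section Equivariant.
Variables (R : realFieldType) (m : nat) (I : finType).
Variables (p : I -> 'rV[R]_m.+1) (K : pred {set I}).
Hypothesis ccK : cone_complex p K.
Hypothesis injp : injective p.
Hypothesis K1 : forall v, K [set v]%SET.
Variable (S : 'I_m.+1 -> I -> I).
Hypothesis Sp : forall j v, p v 0 ord0 = 0 ->
  forall i, p (S j v) 0 (rho j i) = p v 0 i.
Hypothesis SK : forall j (s : {set I}), K s ->
  (forall v, v \in s -> p v 0 ord0 = 0) -> K (S j @: s)%SET.

Lemma facet_preimage j (s : {set I}) : K s ->
  (forall v, v \in s -> p v 0 j = 0) ->
  exists t : {set I}, [/\ K t, forall v, v \in t -> p v 0 ord0 = 0 &
    (S j @: t = s)%SET].
Proof.
move=> Ks sj.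
pose b := \sum_(v in s) p v.
pose y : 'rV[R]_m.+1 := \row_i b 0 (rho j i).
have [|t0 [l [Kt0 l0 lt0 E]]] := cc_cover ccK (y := y).
  by move=> i; rewrite mxE summxE sumr_ge0 // => v _; exact: (cc_ge0 ccK).
pose t := finset (fun v => l v != 0).
have tt0 : t \subset t0.
  by apply/fintype.subsetP => v; rewrite inE; apply: contraNT => /lt0 ->.
have Kt : K t := cc_sub ccK tt0 Kt0.
have t0E v : v \in t -> p v 0 ord0 = 0.
  rewrite inE => lv.
  have : y 0 ord0 = 0 by rewrite mxE rho0 summxE big1.
  rewrite E summxE => /eqP; rewrite psumr_eq0 => [/allP /(_ v)|u _].
    by rewrite mem_index_enum mxE mulf_eq0 (negPf lv) => /(_ isT) /eqP.
  by rewrite mxE mulr_ge0 ?(cc_ge0 ccK).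
exists t; split=> //.
pose mu u := \sum_(v | S j v == u) l v.
have Eb : b = \sum_u mu u *: p u.
  transitivity (\sum_v l v *: p (S j v)).
    apply/rowP => k; rewrite -[k](permKV (rho j)); set i := (_ k).
    have := congr1 (fun z : 'rV_m.+1 => z 0 i) E.
    rewrite mxE => ->; rewrite !summxE; apply: eq_bigr => v _; rewrite !mxE.
    have [->|lv] := eqVneq (l v) 0; first by rewrite !mul0r.
    by rewrite Sp // t0E // inE.
  rewrite (partition_big (S j) xpredT) //=; apply: eq_bigr => u _.
  by rewrite scaler_suml; apply: eq_bigr => v /eqP ->.
have muE : mu =1 (fun u => (u \in s)%:R).
  apply: (cc_uniq ccK (SK j Kt t0E) Ks) => //.
  - by move=> u; rewrite sumr_ge0.
  - move=> u us; rewrite /mu big1 // => v /eqP vu.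
    apply: contraNeq us => lv; rewrite -vu imset_f // inE //.
  - by move=> u /negPf ->.
  rewrite -Eb /b big_mkcond; apply: eq_bigr => v _.
  by case: ifP; rewrite ?scale1r ?scale0r.
apply/finset.setP => u; apply/imsetP/idP => [[v vt ->]|us].
  have : 0 < mu (S j v).
    rewrite /mu (bigD1 v) //= ltr_wpDr ?sumr_ge0 //.
    by move: vt; rewrite inE lt_def l0 andbT.
  by rewrite muE; case: (_ \in s); rewrite ?ltxx.
have /existsP [v /andP [/eqP vu lv]] : [exists v, (S j v == u) && (l v != 0)].
  apply: contraT; rewrite negb_exists => /forallP H.
  have := muE u; rewrite us /mu big1 => [/esym/eqP|v vu]; first by rewrite oner_eq0.
  by have := H v; rewrite vu negbK => /eqP.
by exists v; rewrite ?inE // vu.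
Qed.

Lemma S_inj j v v' : p v 0 ord0 = 0 -> p v' 0 ord0 = 0 -> S j v = S j v' -> v = v'.
Proof.
move=> v0 v'0 E; apply: injp; apply/rowP => i.
by rewrite -(Sp j v0) -(Sp j v'0) E.
Qed.

Let ft (g : {ffun 'I_m -> I}) := K (g @: 'I_m)%SET.
Let Z (g : {ffun 'I_m -> I}) j := [forall i, p (g i) 0 j == 0].

Lemma sum_facet (V : nmodType) (F : {ffun 'I_m -> I} -> V) j :
  \sum_(g | ft g && Z g j) F g =
  \sum_(h | ft h && Z h ord0) F [ffun i => S j (h i)].
Proof.
have -> : \sum_(h | ft h && Z h ord0) F [ffun i => S j (h i)] =
    \sum_(h in finset (fun h => ft h && Z h ord0)) F [ffun i => S j (h i)].
  by apply: eq_bigl => h; rewrite inE.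
rewrite -(big_imset (h := fun h : {ffun 'I_m -> I} => [ffun i => S j (h i)])) /=.
  apply: eq_bigl => g; apply/andP/imsetP => [[Kg /forallP gj]|[h + ->]].
    have [|t [Kt t0 tE]] := facet_preimage (j := j) Kg.
      by move=> v /imsetP [i _ ->]; apply/eqP.
    have /choice [h hP] : forall i, exists v, v \in t /\ S j v = g i.
      move=> i; have : g i \in (g @: 'I_m)%SET by rewrite imset_f.
      by rewrite -tE => /imsetP [v vt ->]; exists v.
    exists (finfun h); last by apply/ffunP => i; rewrite !ffunE; case: (hP i).
    rewrite inE; apply/andP; split.
      apply: (cc_sub ccK _ Kt); apply/fintype.subsetP => v /imsetP [i _ ->].
      by rewrite ffunE; case: (hP i).
    by apply/forallP => i; rewrite ffunE t0 //; case: (hP i).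
  rewrite inE => /andP [Kh /forallP h0]; rewrite /ft; split=> /=.
    have -> : ([ffun i => S j (h i)] @: 'I_m = S j @: (h @: 'I_m))%SET.
      rewrite -imset_comp; apply: eq_imset => i; exact: ffunE.
    by apply: SK => // v /imsetP [i _ ->]; apply/eqP.
  apply/forallP => i; rewrite ffunE -{2}(rho0 j) Sp //; exact/eqP.
move=> h h'; rewrite !inE => /andP [_ /forallP h0] /andP [_ /forallP h'0].
move=> /ffunP E; apply/ffunP => i; have := E i; rewrite !ffunE.
by apply: S_inj; apply/eqP.
Qed.

Variable (L : I -> {set 'I_m.+1}).
Hypothesis SL : forall j v, p v 0 ord0 = 0 -> L (S j v) = (rho j @: L v)%SET.

Lemma label_symmetric v i : p v 0 ord0 = 0 -> p v 0 i = 0 ->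
  (i \in L v) = (ord0 \in L v).
Proof.
move=> v0 vi; have [->//|i0] := eqVneq i ord0.
have [|t [Kt t0 tE]] := facet_preimage (j := i) (K1 v).
  by move=> u /finset.set1P ->.
have : v \in (S i @: t)%SET by rewrite tE finset.set11.
move=> /imsetP [w wt vE]; have w0 := t0 w wt.
have m1 : (1 < m.+1)%N.
  by move: i0; rewrite -val_eqE /= -lt0n => i0; apply: leq_ltn_trans i0 (ltn_ord i).
pose i1 := Ordinal m1.
have r1 : rho i i1 = ord0.
  apply/val_inj; rewrite permE /=.
  by move: i0; rewrite -val_eqE /= -lt0n => ->.
have w1 : p w 0 i1 = 0 by rewrite -(Sp i w0) r1 -vE.
have r11 : rho i1 i1 = ord0 by apply/val_inj; rewrite permE.
have Sw : S i1 w = w.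
  apply: injp; apply/rowP => k; rewrite -[k](permKV (rho i1)); set l := (_ k).
  rewrite Sp //; have [->|l0] := eqVneq l ord0; first by rewrite rho0 w0 w1.
  have [->|l1] := eqVneq l i1; first by rewrite r11 w0 w1.
  congr (p w 0 _); apply/val_inj; rewrite permE /=.
  move: l0 l1; rewrite -!val_eqE /= => /negPf -> l1.
  by case: ifP => //; lia.
have Lw : (i1 \in L w) = (ord0 \in L w).
  have := SL i1 w0; rewrite Sw => LE.
  by rewrite {1}LE -{1}(rho0 i1) mem_imset //; exact: perm_inj.
rewrite vE SL // -{1}(rho0 i) -{2}r1 !mem_imset ?Lw //; exact: perm_inj.
Qed.

Hypothesis Lproper : forall v, L v <> finset.set0 /\ L v <> finset.setT.
Hypothesis prm : prime m.+1.

Let a v : 'rV[int]_m.+1 :=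
  \row_i (if i \in L v then (m`! %/ #|L v|)%N%:Z else 0).

Lemma a_sum v : \sum_i a v 0 i = m`!%:Z.
Proof.
have [/eqP Ln0 /eqP LnT] := Lproper v.
under eq_bigr => i _ do rewrite mxE.
rewrite -big_mkcond sumr_const -mulr_natr natz -PoszM divnK //.
apply: dvdn_fact; rewrite lt0n cards_eq0 Ln0 /= -ltnS.
rewrite -[X in (_ < X)%N]card_ord -cardsT; apply: proper_card.
by rewrite finset.properEneq LnT finset.subsetT.
Qed.

Lemma factp_neq0 : (m`!)%:R != 0 :> 'F_m.+1.
Proof.
have : forall k, (k < m.+1)%N -> (k`!)%:R != 0 :> 'F_m.+1.
  elim=> [|k IH] km; first by rewrite fact0 oner_eq0.
  rewrite factS natrM mulf_neq0 ?IH // 1?ltnW //.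
  rewrite -(dvdn_pcharf (pchar_Fp prm)); apply/negP => /dvdn_leq.
  by move=> /(_ isT); rewrite leqNgt km.
by apply.
Qed.

(* Here the indices start at 0: [ord0] is the index 1 of the paper. *)
Let x t := \sum_(h | ft h && Z h ord0)
  minor (tuple_mx a h id) t * sgz (minor (tuple_mx p h id) ord0).

Lemma in_face_id v : in_face p (id : 'I_m.+1 -> 'I_m.+1) v.
Proof.
by apply/forallP => i; apply/orP; left; apply/codomP; exists i.
Qed.

Lemma face_tuple_id q (g : {ffun 'I_q -> I}) :
  face_tuple p K (id : 'I_m.+1 -> 'I_m.+1) g = K (g @: 'I_q)%SET.
Proof.
rewrite /face_tuple; have -> : [forall i, in_face p id (g i)]; last exact: andbT.
by apply/forallP => i; exact: in_face_id.
Qed.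

Lemma sum_x_neq0 : (\sum_t x t)%:~R != 0 :> 'F_m.+1.
Proof.
pose al v : 'rV['F_m.+1]_m.+1 := \row_i (a v 0 i - a v 0 ord0)%:~R.
have faceE v : in_face p (lift (ord0 : 'I_m.+1)) v = (p v 0 ord0 == 0).
  have -> : lift (ord0 : 'I_m.+1) = id \o lift ord0 by [].
  by rewrite in_face_lift // in_face_id.
have Fn : m.+1%:R = 0 :> 'F_m.+1 by rewrite (pcharf0 (pchar_Fp prm)).
have al_sum v : in_face p (lift ord0) v -> \sum_i al v 0 i = m`!%:R.
  move=> _; under eq_bigr => i _ do rewrite mxE rmorphB.
  rewrite sumrB -rmorph_sum /= a_sum sumr_const card_ord -[_ *+ _]mulr_natl Fn.
  by rewrite mul0r subr0.
have al0 v i : in_face p (lift ord0) v -> p v 0 i = 0 -> al v 0 i = 0.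
  rewrite faceE => /eqP v0 vi; rewrite !mxE label_symmetric //.
  by rewrite subrr.
have E := sperner_sum ccK (@lift_inj _ _) al_sum al0.
suff -> : (\sum_t x t)%:~R = m`!%:R * m`!%:R ^+ m :> 'F_m.+1.
  by rewrite mulf_neq0 ?expf_neq0 ?factp_neq0.
rewrite -E /x exchange_big rmorph_sum /=; apply: eq_big => h.
  rewrite /face_tuple; congr (_ && _).
  by apply: eq_forallb => i; rewrite faceE.
move=> _; rewrite -mulr_suml sum_minor rmorphM mulrC; congr (_ * _).
  rewrite /minor expr0 mul1r; congr (sgz (\det _))%:~R.
  by apply/matrixP => i j; rewrite !mxE.
rewrite -det_map_mx; congr (\det _); apply/matrixP => i j.
by rewrite !mxE.
Qed.

Hypothesis noT : forall (f : {ffun 'I_m.+1 -> I}) (s : 'S_m.+1),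
  K (f @: 'I_m.+1)%SET -> injective f -> exists i, s i \notin L (f i).

Lemma sum_x_rho c : \sum_j x ((rho j)^-1 c)%g = 0.
Proof.
pose B g := minor (tuple_mx a g id) c.
have S0 : \sum_(f : {ffun 'I_m.+1 -> I} | face_tuple p K id f)
     (sgz (\det (tuple_mx p f id)))%:~R *
     \sum_(i < m.+1) (-1) ^+ i * B (ffun_drop i f) = 0.
  apply: big1 => f; rewrite face_tuple_id => Kf.
  have [->|P0] := eqVneq (\det (tuple_mx p f id)) 0; first by rewrite sgz0 mul0r.
  have injf : injective f.
    move=> i j fij; apply/eqP; apply: contraNT P0 => ij; apply/eqP.
    by apply: (determinant_alternate ij) => k; rewrite !mxE fij.
  have A0 : \det (tuple_mx a f id) = 0.
    apply/eqP; apply: contraT => /det_neq0_perm [s sP].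
    have [i] := noT s Kf injf; have := sP i; rewrite !mxE.
    by case: ifP => //; rewrite eqxx.
  have : \det (tuple_mx a f id) =
      m`!%:Z * \sum_(i < m.+1) (-1) ^+ i * B (ffun_drop i f).
    rewrite (det_rowsum (a := m`!%:Z) c) => [|i]; last first.
      by rewrite -(a_sum (f i)); apply: eq_bigr => k _; rewrite mxE.
    by congr (_ * _); apply: eq_bigr => i _; rewrite row'_tuple_mx.
  rewrite A0 => /esym/eqP.
  rewrite mulf_eq0 => /orP [|/eqP ->]; last by rewrite mulr0.
  by rewrite eqz_nat -leqn0 leqNgt fact_gt0.
move/eqP: S0; rewrite (stokes ccK B (@inj_id _)) mulf_eq0 pnatr_eq0 /= => /eqP.
rewrite (eq_bigl ft) => [|g]; last exact: face_tuple_id.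
under eq_bigr => g _ do rewrite intz mulr_sumr.
rewrite (exchange_big_dep xpredT) //= => S0; rewrite -[RHS]S0.
apply: eq_bigr => j _. rewrite [RHS]sum_facet. apply: eq_bigr => h /andP [_ /forallP h0].
have key (V : comPzRingType) (y : I -> 'rV[V]_m.+1) t :
    (forall k i, y (S j (h k)) 0 (rho j i) = y (h k) 0 i) ->
    minor (tuple_mx y [ffun i => S j (h i)] id) (rho j t) =
    (-1) ^+ j * minor (tuple_mx y h id) t.
  move=> yS; rewrite -[in RHS]signr_odd -odd_rho; apply: minor_perm => k i.
  by rewrite !mxE ffunE.
have Ba := key _ a ((rho j)^-1 c)%g; rewrite permKV in Ba.
have Pp := key _ p ord0; rewrite rho0 in Pp.
rewrite /B Ba => [|k i]; last first.
  by rewrite !mxE SL ?(eqP (h0 k)) // mem_imset ?card_imset //; exact: perm_inj.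
rewrite Pp => [|k i]; last by rewrite Sp // (eqP (h0 k)).
rewrite [sgz ((-1) ^+ j * _)]sgzM -(signr_odd R) -(signr_odd int); case: (odd j) => /=.
  by rewrite !expr1 sgzN1 !mulN1r mulrNN.
by rewrite !expr0 sgz1 !mul1r.
Qed.

Lemma no_transversal_absurd : False.
Proof.
have Fn : m.+1%:R = 0 :> 'F_m.+1 by rewrite (pcharf0 (pchar_Fp prm)).
pose X t : 'F_m.+1 := (x t)%:~R.
have XE k (km : (k < m.+1)%N) : X (Ordinal km) = X ord0.
  elim: k km => [|k IH] km; first by congr X; apply: val_inj.
  have km' : (k < m.+1)%N by rewrite ltnW.
  pose Y (j : 'I_m.+1) : 'F_m.+1 := if (k < j)%N then X (Ordinal km) else X ord0.
  have : \sum_j Y j = 0.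
    have := congr1 (fun z : int => z%:~R : 'F_m.+1) (sum_x_rho (Ordinal km')).
    rewrite rmorph_sum /= => H; rewrite -[RHS]H; apply: eq_bigr => j _; rewrite /Y -/(X _).
    case: ltngtP => kj.
    - congr X; apply: (@perm_inj _ (rho j)); rewrite permKV.
      by apply/val_inj; rewrite permE /= kj.
    - rewrite -(IH km'); congr X; apply: (@perm_inj _ (rho j)); rewrite permKV.
      apply/val_inj; rewrite permE /=.
      by case: (k =P 0%N) => [k0|_]; [lia|rewrite leqNgt kj].
    - congr X; apply: (@perm_inj _ (rho j)); rewrite permKV rho0.
      by apply/val_inj.
  rewrite (bigID (fun j : 'I_m.+1 => (k < j)%N)) /=.
  rewrite (eq_bigr (fun=> X (Ordinal km))) => [|j kj]; last by rewrite /Y kj.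
  rewrite [X in _ + X](eq_bigr (fun=> X ord0)) => [|j kj]; last first.
    by rewrite /Y (negPf kj).
  rewrite !sumr_const.
  set N1 := #|_|; set N2 := #|_|.
  have N12 : (N1 + N2)%N = m.+1.
    by rewrite -[RHS]card_ord -(cardC (fun j : 'I_m.+1 => (k < j)%N)).
  have N1E : N1%:R = - N2%:R :> 'F_m.+1.
    by apply/eqP; rewrite -addr_eq0 -natrD N12 Fn.
  rewrite -[X _ *+ N1]mulr_natr -[X _ *+ N2]mulr_natr N1E mulrN addrC -mulrBl => /eqP; rewrite mulf_eq0.
  case/orP => [|]; first by rewrite subr_eq0 => /eqP.
  rewrite -(dvdn_pcharf (pchar_Fp prm)) => /dvdn_leq.
  have N1p : (0 < N1)%N by apply/card_gt0P; exists (Ordinal km); exact: ltnSn.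
  have N2p : (0 < N2)%N.
    by apply/card_gt0P; exists (Ordinal km'); rewrite unfold_in -leqNgt leqnn.
  by move=> /(_ N2p); lia.
have /eqP := sum_x_neq0; apply.
rewrite rmorph_sum /= (eq_bigr (fun=> X ord0)) => [|[k km] _]; last exact: XE.
by rewrite sumr_const card_ord -mulr_natl Fn mul0r.
Qed.

End Equivariant.

(** * The cone complex of a triangulation *)

Section TriangulationComplex.
Variables (R : realType) (n : nat) (T : {fset {fset 'rV[R]_n}}).
Hypothesis triT : triangulation T.

Definition vertices : {fset 'rV[R]_n} := (\bigcup_(s <- T) s)%fset.

Definition fset_of (s : {set vertices}) : {fset 'rV[R]_n} :=
  [fset val v | v in s]%fset.

Definition simplex_or_empty (s : {set vertices}) : bool :=
  (s == finset.set0) || (fset_of s \in T).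

Lemma mem_fset_of (s : {set vertices}) v : (val v \in fset_of s) = (v \in s).
Proof. by rewrite mem_imfset //; exact: val_inj. Qed.

Lemma sum_fset_of (V : nmodType) (s : {set vertices}) (F : 'rV[R]_n -> V) :
  \sum_(x <- fset_of s) F x = \sum_(v in s) F (val v).
Proof.
rewrite big_imfset /=; last by move=> u v _ _; exact: val_inj.
by rewrite -big_enum.
Qed.

Lemma fset_of_surj t : (t `<=` vertices)%fset ->
  t = fset_of (finset (fun v : vertices => val v \in t)).
Proof.
move=> tV; apply/fsetP => x; apply/idP/imfsetP => [xt|[v + ->]]; last by rewrite inE.
by exists [` fsubsetP tV x xt]%fset; rewrite //= inE.
Qed.

Lemma simplex_vertices t : t \in T -> (t `<=` vertices)%fset.
Proof. by move=> tT; apply/fsubsetP => x xt; apply/bigfcupP; exists t; rewrite ?tT. Qed.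

Lemma hull_fset_of (s : {set vertices}) x : hull (fset_of s) x <->
  exists w : vertices -> R, [/\ forall v, 0 <= w v,
    forall v, v \notin s -> w v = 0, \sum_v w v = 1 &
    x = \sum_v w v *: val v].
Proof.
split=> [[w [w0 w1 ->]]|[w [w0 ws w1 ->]]].
  exists (fun v => if v \in s then w (val v) else 0); split.
  - by move=> v; case: ifP => // vs; rewrite w0 // mem_fset_of.
  - by move=> v /negPf ->.
  - by rewrite -big_mkcond -[RHS]w1 sum_fset_of.
  - rewrite sum_fset_of big_mkcond; apply: eq_bigr => v _.
    by case: ifP; rewrite ?scale0r.
exists (fun y => oapp w 0 (insub y)); split.
- by move=> y _; case: insub => //=.
- rewrite sum_fset_of -[RHS]w1 big_mkcond; apply: eq_bigr => v _.
  by rewrite valK /=; case: ifPn => // /ws.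
- rewrite sum_fset_of [RHS]big_mkcond; apply: eq_bigr => v _.
  by rewrite valK /=; case: ifPn => // /ws ->; rewrite scale0r.
Qed.

Lemma vertex_vertices (v : vertices) : vertex T (val v).
Proof.
have [_ sub _ _] := triT.
have /bigfcupP [s /andP [sT _] vs] := valP v.
apply: sub sT _ _; last by rewrite fsub1set.
by rewrite -cardfs_eq0 cardfs1.
Qed.

Lemma fset_of1 (v : vertices) : fset_of [set v]%SET = [fset val v]%fset.
Proof.
apply/fsetP => x; rewrite inE; apply/imfsetP/eqP => [[u /set1P -> //]|->].
by exists v; rewrite ?inE.
Qed.

Lemma simplex_or_empty1 v : simplex_or_empty [set v]%SET.
Proof. by rewrite /simplex_or_empty fset_of1 vertex_vertices orbT. Qed.

Lemma hull_std s x : s \in T -> hull s x -> std_simplex x.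
Proof. by case: triT => _ _ _ <- sT sx; exists s. Qed.

Lemma vertex_std (v : vertices) : std_simplex (val v).
Proof.
apply: (hull_std (vertex_vertices v)); rewrite -fset_of1; apply/hull_fset_of.
exists (fun u => (u == v)%:R); split.
- by move=> u; rewrite ler0n.
- by move=> u; rewrite inE => /negPf ->.
- by rewrite (bigD1 v) //= eqxx big1 ?addr0 // => u /negPf ->.
- rewrite (bigD1 v) //= eqxx scale1r big1 ?addr0 // => u /negPf ->.
  by rewrite scale0r.
Qed.

Lemma coord_sum (w : vertices -> R) :
  \sum_i (\sum_v w v *: val v) 0 i = \sum_v w v.
Proof.
under eq_bigr => i _ do rewrite summxE.
rewrite exchange_big; apply: eq_bigr => v _ /=.
under eq_bigr => i _ do rewrite mxE.
by rewrite -mulr_sumr; case: (vertex_std v) => _ ->; rewrite mulr1.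
Qed.

Lemma simplex_free (s : {set vertices}) (w : vertices -> R) :
  simplex_or_empty s -> (forall v, v \notin s -> w v = 0) ->
  \sum_v w v *: val v = 0 -> forall v, w v = 0.
Proof.
move=> /orP [/eqP ->|sT] ws E v; first by rewrite ws // inE.
have [vs|/ws //] := boolP (v \in s).
have [/(_ _ sT) [_ free] _ _ _] := triT.
suff : oapp w 0 (insub (val v)) = 0 by rewrite valK.
apply: (free (fun y => oapp w 0 (insub y))); last by rewrite mem_fset_of.
  rewrite sum_fset_of; have := coord_sum w; rewrite E.
  rewrite big1 => [|i _]; last by rewrite mxE.
  move=> /esym w0; rewrite -[RHS]w0 big_mkcond; apply: eq_bigr => u _.
  by rewrite valK /=; case: ifPn => // /ws.
rewrite sum_fset_of -[RHS]E big_mkcond; apply: eq_bigr => u _.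
by rewrite valK /=; case: ifPn => // /ws ->; rewrite scale0r.
Qed.

Lemma hull_scale (s : {set vertices}) (w : vertices -> R) a :
  0 < a -> (forall v, 0 <= w v) -> (forall v, v \notin s -> w v = 0) ->
  \sum_v w v = a -> hull (fset_of s) (a^-1 *: \sum_v w v *: val v).
Proof.
move=> a0 w0 ws wa; apply/hull_fset_of; exists (fun v => a^-1 * w v); split.
- by move=> v; rewrite mulr_ge0 // invr_ge0 ltW.
- by move=> v /ws ->; rewrite mulr0.
- by rewrite -mulr_sumr wa mulVf // gt_eqF.
- by rewrite scaler_sumr; apply: eq_bigr => v _; rewrite scalerA.
Qed.

Lemma triangulation_cone_complex :
  cone_complex (val : vertices -> 'rV[R]_n) simplex_or_empty.
Proof.
have [_ sub meet cover] := triT; split.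
- by move=> v i; case: (vertex_std v).
- move=> s t ts /orP [/eqP s0|sT].
    by move: ts; rewrite s0 finset.subset0 /simplex_or_empty => ->.
  rewrite /simplex_or_empty; case: eqVneq => //= t0.
  apply: sub sT _ _.
    have /set0Pn [v vt] := t0; apply: contraTneq vt => E.
    by rewrite -mem_fset_of E inE.
  apply/fsubsetP => x /imfsetP [v /= vt ->]; rewrite mem_fset_of.
  exact: (fintype.subsetP ts).
- exact: simplex_free.
- move=> s t w z Ks Kt w0 z0 ws zt E.
  have := congr1 (fun y : 'rV[R]_n => \sum_i y 0 i) E.
  rewrite !coord_sum; set a := \sum_v w v => az.
  have [a0|an0] := eqVneq a 0.
    move=> v; move: az; rewrite a0 => /esym/eqP; rewrite psumr_eq0 //.
    move=> /allP /(_ v); rewrite mem_index_enum => /(_ isT) /eqP ->.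
    move: a0 => /eqP; rewrite psumr_eq0 // => /allP /(_ v).
    by rewrite mem_index_enum => /(_ isT) /eqP.
  have a0 : 0 < a by rewrite lt_def an0 sumr_ge0.
  have nonempty (s' : {set vertices}) (w' : vertices -> R) :
      simplex_or_empty s' -> (forall v, v \notin s' -> w' v = 0) ->
      \sum_v w' v = a -> fset_of s' \in T.
    move=> /orP [/eqP ->|//] w's w'a; case/eqP: an0; rewrite -w'a big1 // => v _.
    by rewrite w's // inE.
  have sT := nonempty s w Ks ws erefl.
  have tT := nonempty t z Kt zt (esym az).
  have [u [us ut hullE]] := meet _ _ sT tT.
  have : hull u (a^-1 *: \sum_v w v *: val v).
    by rewrite -hullE; split; [|rewrite E]; apply: hull_scale.
  have uV : (u `<=` vertices)%fset.
    exact: fsubset_trans us (simplex_vertices sT).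
  rewrite (fset_of_surj uV) => /hull_fset_of [y [y0 yu y1 yE]].
  have yE' : \sum_v w v *: val v = \sum_v (a * y v) *: val v.
    rewrite -[LHS](scalerKV (a := a)) ?gt_eqF // yE scaler_sumr.
    by apply: eq_bigr => v _; rewrite scalerA.
  have unique (s' : {set vertices}) (w' : vertices -> R) :
      simplex_or_empty s' -> (forall v, v \notin s' -> w' v = 0) ->
      (u `<=` fset_of s')%fset ->
      \sum_v w' v *: val v = \sum_v (a * y v) *: val v ->
      forall v, w' v = a * y v.
    move=> Ks' w's us' E' v; apply/eqP; rewrite -subr_eq0; apply/eqP.
    apply: (simplex_free (w := fun v => w' v - a * y v) Ks') => [x xs|].
      rewrite w's // yu ?mulr0 ?subr0 // inE; apply: contra xs => xu.
      by rewrite -mem_fset_of (fsubsetP us').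
    under eq_bigr => x _ do rewrite scalerBl.
    by rewrite sumrB E' subrr.
  move=> v; rewrite (unique s w) // (unique t z) // -E //.
move=> y y0; pose a := \sum_i y 0 i.
have [a0|an0] := eqVneq a 0.
  exists finset.set0, (fun=> 0); split=> //; first by rewrite /simplex_or_empty eqxx.
  rewrite big1 => [|v _]; last by rewrite scale0r.
  apply/rowP => i; rewrite mxE; move: a0 => /eqP; rewrite psumr_eq0 //.
  by move=> /allP /(_ i); rewrite mem_index_enum => /(_ isT) /eqP.
have a0 : 0 < a by rewrite lt_def an0 sumr_ge0.
have : std_simplex (a^-1 *: y).
  split=> [i|]; first by rewrite mxE mulr_ge0 // invr_ge0 ltW.
  under eq_bigr => i _ do rewrite mxE.
  by rewrite -mulr_sumr mulVf.
rewrite -cover => -[s /= sT]; rewrite (fset_of_surj (simplex_vertices sT)).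
move=> /hull_fset_of [w [w0 ws w1 E]].
exists (finset (fun v : vertices => val v \in s)), (fun v => a * w v); split.
- by rewrite /simplex_or_empty -fset_of_surj ?sT ?orbT // simplex_vertices.
- by move=> v; rewrite mulr_ge0 // ltW.
- by move=> v /ws ->; rewrite mulr0.
- rewrite -[LHS](scalerKV (a := a)) // E scaler_sumr.
  by apply: eq_bigr => v _; rewrite scalerA.
Qed.

End TriangulationComplex.

Lemma r_rho (R : realType) (n : nat) (j i : 'I_n) (x : 'rV[R]_n) :
  r j x 0 (rho j i) = x 0 i.
Proof.
rewrite /r summxE (bigD1 i) //= big1 ?addr0 => [|k ki].
  by rewrite !mxE !eqxx mulr1.
by rewrite !mxE (inj_eq perm_inj) eq_sym (negPf ki) andbF mulr0.
Qed.

Theorem theorem2 (R : realType) (n : nat) (T : {fset {fset 'rV[R]_n}})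
    (L : 'rV[R]_n -> {set 'I_n}) :
  prime n ->
  nice_triangulation T ->
  (forall v : 'rV[R]_n, vertex T v -> L v <> finset.set0 /\ L v <> finset.setT) ->
  nice_labeling T L ->
  exists tau : {fset 'rV[R]_n},
    [/\ tau \in T,
        simplex_dim tau = n.-1 &
        exists l : 'rV[R]_n -> 'I_n,
          (forall u, u \in tau -> l u \in L u) /\
          (forall u v, u \in tau -> v \in tau -> l u = l v -> u = v)].
Proof.
case: n T L => // m T L prm [triT niceT] Lproper niceL.
apply: contrapT => noTau.
pose S j (v : vertices T) : vertices T := insubd v (r j (val v)).
have face0 (s : {set vertices T}) : fset_of s \in T ->
    (forall v, v \in s -> val v 0 ord0 = 0) ->
    (hull (fset_of s) `<=` facet ord0)%classic.
  move=> sT s0 x sx; split; first exact: hull_std sT sx.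
  have [w [_ ws _ ->]] := (hull_fset_of s x).1 sx.
  rewrite summxE big1 // => v _; rewrite mxE.
  by have [/s0 ->|/ws ->] := boolP (v \in s); rewrite ?mulr0 ?mul0r.
have vS j (v : vertices T) : val v 0 ord0 = 0 -> val (S j v) = r j (val v).
  move=> v0; rewrite val_insubd; case: ifP => // /negP []; apply/bigfcupP.
  exists [fset r j u | u in fset_of [set v]%SET]%fset; last first.
    by apply/imfsetP; exists (val v); rewrite //= mem_fset_of inE.
  have vT : fset_of [set v]%SET \in T by rewrite fset_of1; exact: vertex_vertices.
  rewrite andbT; apply: (niceT ord0 j) => //; apply: face0 => // u.
  by move=> /set1P ->.
apply: (@no_transversal_absurd R m (vertices T) val (simplex_or_empty (T := T))
  (triangulation_cone_complex triT) val_inj (simplex_or_empty1 triT) S _ _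
  (fun v => L (val v))) => //.
- by move=> j v v0 i; rewrite vS // r_rho.
- move=> j s /orP [/eqP ->|sT] s0; first by rewrite imset0 /simplex_or_empty eqxx.
  apply/orP; right; suff -> : fset_of (S j @: s)%SET = [fset r j u | u in fset_of s]%fset.
    by apply: (niceT ord0 j) => //; exact: face0.
  apply/fsetP => x; apply/imfsetP/imfsetP => /= -[u].
    move=> /imsetP [v vs ->] ->; exists (val v); rewrite ?mem_fset_of //.
    by rewrite vS // s0.
  move=> /imfsetP [v /= vs ->] ->; exists (S j v); first exact: imset_f.
  by rewrite vS // s0.
- move=> j v v0; rewrite vS //; apply: (niceL ord0 j) => //.
    exact: vertex_vertices.
  by split=> //; exact: vertex_std.
- by move=> v; apply: Lproper; exact: vertex_vertices.
move=> f s /orP [/eqP E|fT] injf.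
  have : f ord0 \in (f @: 'I_m.+1)%SET by apply: imset_f.
  by rewrite E inE.
apply/existsP; apply: contrapT => /negP; rewrite negb_exists => /forallP sL.
apply: noTau; exists (fset_of (f @: 'I_m.+1)%SET); split=> //.
  rewrite /simplex_dim card_imfset /=; last exact: val_inj.
  by rewrite -cardE card_imset // card_ord.
exists (fun x => if [pick i | val (f i) == x] is Some i then s i else ord0).
have lE i : (if [pick k | val (f k) == val (f i)] is Some k then s k else ord0)
    = s i.
  case: pickP => [k /eqP /val_inj /injf -> //|/(_ i)].
  by rewrite eqxx.
split=> [u /imfsetP [v /= /imsetP [i _ ->] ->]|].
  by rewrite lE; apply: contraT => /negP; have := sL i; rewrite negbK.
move=> u u' /imfsetP [v /= /imsetP [i _ ->] ->].
move=> /imfsetP [v' /= /imsetP [i' _ ->] ->].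
by rewrite !lE => /perm_inj ->.
Qed.
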